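(* Let $N$ be an even positive integer, let $X(0),X(1),\dots,X(N/2-1)$ be real numbers, and let $$J(\tau)=2\sum_{u=0}^{N/2-1}X(u)\Bigl(1+\cos\bigl(\tfrac{2\pi}{N}\tau u\bigr)\Bigr),\qquad \tau=1,\dots,N.$$ Then $X$ can be calculated from $J$ as follows: $$X(u)=\begin{cases}\dfrac1N\displaystyle\sum_{\tau=1}^{N}J(\tau)\cos\bigl(\tfrac{2\pi}{N}\tau u\bigr), & u=1,\dots,N/2-1,\\[2mm] \dfrac1{4N}\displaystyle\sum_{\tau=1}^{N}J(\tau)-\dfrac12\sum_{u_1=1}^{N/2-1}X(u_1), & u=0.\end{cases}$$ Moreover, let $$x(u)=\operatorname{Re}\Bigl(\mathrm{IFFT}(J)(u)\cdot\exp\bigl(j\tfrac{2\pi}{N}(u-1)\bigr)\Bigr),\qquad u=1,\dots,N,$$ where $\mathrm{IFFT}$ is applied to the sequence $(J(1),\dots,J(N))$. Then $$X(u)=\begin{cases}x(u+1), & u=1,\dots,N/2-1,\\[1mm] \dfrac1{4N}\displaystyle\sum_{\tau=1}^{N}J(\tau)-\dfrac12\sum_{u_1=1}^{N/2-1}X(u_1), & u=0.\end{cases}$$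
   Context: Here $j$ is the imaginary unit. For a sequence $y=(y_1,\dots,y_N)$ of complex numbers, the inverse FFT (MATLAB convention) is the sequence indexed by $u=1,\dots,N$ given by $$\mathrm{IFFT}(y)(u)=\frac1N\sum_{k=1}^{N}y_k\exp\bigl(j\tfrac{2\pi}{N}(k-1)(u-1)\bigr).$$ *)

(* Defs.v *)
From HB Require Import structures.
From mathcomp Require Import all_boot all_order all_algebra.
From mathcomp Require Import complex.
From mathcomp Require Import reals sequences exp trigo.

Set Implicit Arguments.
Unset Strict Implicit.
Unset Printing Implicit Defensive.

Import Order.TTheory GRing.Theory Num.Theory.

Local Open Scope ring_scope.
Local Open Scope complex_scope.

(* exp (a + j b) = e^a (cos b + j sin b) *)
Definition cexp (R : realType) (z : R[i]) : R[i] :=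
  (expR (complex.Re z))%:C *
  (cos (complex.Im z) +i* sin (complex.Im z)).

(* The sequences y and ifft N y are 1-based: only the indices 1, ..., N are
   meaningful. The shifts k - 1 and u - 1 are taken in R, not truncated in nat. *)
Definition ifft (R : realType) (N : nat) (y : nat -> R[i]) (u : nat) : R[i] :=
  N%:R^-1 * \sum_(1 <= k < N.+1)
    y k * cexp ('i%C * (2 * pi / N%:R * (k%:R - 1) * (u%:R - 1))%:C).

(* Main.v *)
Require Import Defs.
From HB Require Import structures.
From mathcomp Require Import all_boot all_order all_algebra.
From mathcomp Require Import complex.
From mathcomp Require Import reals sequences exp trigo.
From mathcomp Require Import ring zify.

Set Implicit Arguments.
Unset Strict Implicit.
Unset Printing Implicit Defensive.

Import Order.TTheory GRing.Theory Num.Theory.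

Local Open Scope ring_scope.
Local Open Scope complex_scope.

(** The formulas are a discrete cosine inversion. Over a full period
    tau = 1, ..., N, the functions tau |-> cos (2 pi tau m / N) sum to zero
    unless N divides m ([sum_cos_period]). By the product-to-sum formula the
    functions of frequencies u and v, with 0 <= u, v < N / 2, are therefore
    orthogonal: both u + v and |u - v| are below N, so a nonzero sum can only
    come from a zero frequency ([sum_cosM_period]). The restriction to
    frequencies below N / 2 is what rules out the aliasing u + v = N.

    Pairing J with the cosine of frequency u > 0 kills the constant term and all
    other frequencies, and leaves N X(u). Frequency 0 is confounded with the
    constant term 2 sum X(v) of J, so summing J gives 2 N (sum X(v) + X(0)), and
    X(0) is recovered once the other values are known.

    For the second part, IFFT indexes time from k - 1 whereas the cosine sum
    uses k; multiplying by exp (2 pi j (u - 1) / N) restores the missing phase,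
    so that x(u) is 1 / N times the cosine sum of frequency u - 1
    ([Re_ifft_shift]). *)

(** Multiplying by 2 sin (a / 2) makes the sum telescope. *)
Lemma dirichlet_sum (R : realType) (n : nat) (a : R) :
  2 * sin (a / 2) * \sum_(1 <= k < n.+1) cos (a * k%:R) =
  sin (a / 2 + a * n%:R) - sin (a / 2).
Proof.
elim: n => [|n IHn]; first by rewrite big_geq // !mulr0 addr0 subrr.
rewrite big_nat_recr //= mulrDr IHn.
(* The new term is centred at a * (n + 1), half a step from both sines. *)
have -> : a / 2 + a * n%:R = a * n.+1%:R - a / 2 by rewrite -natr1; field.
by rewrite sinB sinD; ring.
Qed.

Lemma sum_cos_period (R : realType) (N m : nat) : (0 < m < N)%N ->
  \sum_(1 <= tau < N.+1) cos (2 * pi / N%:R * tau%:R * m%:R) = 0 :> R.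
Proof.
move=> /andP[m_gt0 m_ltN].
have N_gt0 : 0 < N%:R :> R by rewrite ltr0n (leq_trans _ m_ltN).
have N_neq0 : N%:R != 0 :> R by rewrite gt_eqF.
pose a : R := 2 * pi / N%:R * m%:R.
have sin_neq0 : 2 * sin (a / 2) != 0.
  (* Half the step, pi m / N, lies strictly between 0 and pi. *)
  have -> : a / 2 = pi * (m%:R / N%:R) by rewrite /a; field.
  apply/lt0r_neq0/mulr_gt0/sin_gt0_pi/andP; first by rewrite ltr0n.
  split.
    by rewrite mulr_gt0 ?pi_gt0 // divr_gt0 // ltr0n.
  by rewrite gtr_pMr ?pi_gt0 // ltr_pdivrMr // mul1r ltr_nat.
apply: (mulfI sin_neq0); rewrite mulr0.
under eq_bigr => tau _ do rewrite mulrAC -/a.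
rewrite dirichlet_sum.
have -> : a * N%:R = pi *+ 2 *+ m by rewrite -mulr_natr /a -mulr_natr; field.
by rewrite (periodicn (@sinD2pi R)) subrr.
Qed.

(** The bound on u + v excludes aliasing between the two frequencies. *)
Lemma sum_cosM_period (R : realType) (N u v : nat) :
  (0 < u)%N -> (u + v < N)%N ->
  \sum_(1 <= tau < N.+1) cos (2 * pi / N%:R * tau%:R * u%:R) *
                         cos (2 * pi / N%:R * tau%:R * v%:R) =
  (if u == v then N%:R / 2 else 0) :> R.
Proof.
move=> u_gt0 uvN.
pose d := `|u%:Z - v%:Z|%N.
have split_prod (b : R) : cos (b * u%:R) * cos (b * v%:R) =
    2^-1 * (cos (b * (u + v)%:R) + cos (b * d%:R)).
  have -> : cos (b * d%:R) = cos (b * u%:R - b * v%:R).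
    rewrite -mulrBr /d.
    case: (leqP v u) => [vu|/ltnW uv].
      by rewrite distnEl // natrB.
    by rewrite distnEr // natrB // -opprB mulrN cosN.
  by rewrite cosB natrD (mulrDr b) cosD; field.
under eq_bigr => tau _ do rewrite split_prod.
rewrite -mulr_sumr big_split /= sum_cos_period ?uvN ?addn_gt0 ?u_gt0 // add0r.
have [eq_uv|neq_uv] := eqVneq u v.
  under eq_bigr => tau _ do rewrite /d eq_uv subrr mulr0 cos0.
  by rewrite sumr_const_nat subn1 /= mulrC.
by rewrite sum_cos_period ?mulr0 // /d; lia.
Qed.

Lemma cexp_im (R : realType) (t : R) :
  cexp ('i%C * t%:C) = cos t +i* sin t.
Proof.
by rewrite /cexp /= !mul0r !mul1r subrr add0r expR0 mul1r.
Qed.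

Lemma cexp_imD (R : realType) (s t : R) :
  cexp ('i%C * s%:C) * cexp ('i%C * t%:C) = cexp ('i%C * (s + t)%:C).
Proof.
rewrite !cexp_im; apply/eqP; rewrite eq_complex /= cosD sinD.
by rewrite eqxx addrC eqxx.
Qed.

Lemma Re_sum (R : realType) (I : Type) (r : seq I) (F : I -> R[i]) :
  complex.Re (\sum_(i <- r) F i) = \sum_(i <- r) complex.Re (F i).
Proof. by apply: (big_morph (@complex.Re R)) => // -[? ?] [? ?]. Qed.

Lemma Re_realM (R : realType) (t : R) (z : R[i]) :
  complex.Re (t%:C * z) = t * complex.Re z.
Proof. by case: z => a b /=; rewrite mul0r subr0. Qed.

(** The extra factor turns the time index k - 1 of the inverse FFT into k. *)
Lemma Re_ifft_shift (R : realType) (N : nat) (y : nat -> R) (u : nat) :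
  complex.Re (ifft N (fun k => (y k)%:C) u *
              cexp ('i%C * (2 * pi / N%:R * (u%:R - 1))%:C)) =
  N%:R^-1 * \sum_(1 <= k < N.+1)
              y k * cos (2 * pi / N%:R * k%:R * (u%:R - 1)).
Proof.
have invNC : N%:R^-1 = (N%:R^-1 : R)%:C by rewrite fmorphV /= rmorph_nat.
rewrite /ifft invNC -[X in complex.Re X]mulrA Re_realM mulr_suml Re_sum; congr (_ * _).
apply: eq_bigr => k _.
rewrite -[X in complex.Re X]mulrA cexp_imD Re_realM cexp_im /=; congr (_ * cos _).
by ring.
Qed.

Section Inversion.

Variables (R : realType) (N : nat) (X J : nat -> R).
Hypothesis JE : forall tau : nat, (1 <= tau <= N)%N ->
  J tau = 2 * \sum_(0 <= u < N./2)
                X u * (1 + cos (2 * pi / N%:R * tau%:R * u%:R)).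

(** Exchanging sums reduces pairing J with any weight w to pairing w with
    the individual cosines. *)
Lemma pair_J (w : nat -> R) :
  \sum_(1 <= tau < N.+1) J tau * w tau =
  2 * \sum_(0 <= v < N./2) X v *
        (\sum_(1 <= tau < N.+1) w tau +
         \sum_(1 <= tau < N.+1) w tau * cos (2 * pi / N%:R * tau%:R * v%:R)).
Proof.
under eq_big_nat => tau tauN do rewrite JE // -mulrA mulr_suml.
rewrite -mulr_sumr exchange_big; congr (_ * _); apply: eq_bigr => v _ /=.
rewrite -big_split mulr_sumr; apply: eq_bigr => tau _ /=.
by ring.
Qed.

Lemma cos_inversion (u : nat) : (1 <= u < N./2)%N ->
  X u = N%:R^-1 * \sum_(1 <= tau < N.+1)
                    J tau * cos (2 * pi / N%:R * tau%:R * u%:R).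
Proof.
move=> /andP[u_gt0 u_lt].
have N_neq0 : N%:R != 0 :> R by rewrite pnatr_eq0; lia.
rewrite pair_J sum_cos_period; last by lia.
have pick v : (0 <= v < N./2)%N ->
    X v * (0 + \sum_(1 <= tau < N.+1)
             cos (2 * pi / N%:R * tau%:R * u%:R) *
             cos (2 * pi / N%:R * tau%:R * v%:R)) =
    (if v == u then X u * (N%:R / 2) else 0).
  move=> v_lt; rewrite add0r sum_cosM_period //; last by lia.
  by rewrite eq_sym; case: eqVneq => [->|]; rewrite ?mulr0.
rewrite (eq_big_nat _ _ pick) -big_mkcond big_nat1_eq /= u_lt.
by field.
Qed.

Lemma mean_inversion : (0 < N)%N -> ~~ odd N ->
  X 0%N = (4 * N%:R)^-1 * \sum_(1 <= tau < N.+1) J tau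
          - 2^-1 * \sum_(1 <= u1 < N./2) X u1.
Proof.
move=> N_gt0 N_even.
have N_neq0 : N%:R != 0 :> R by rewrite pnatr_eq0 -lt0n.
have half_gt0 : (0 < N./2)%N by lia.
have sum1 : \sum_(1 <= tau < N.+1) (1 : R) = N%:R.
  by rewrite sumr_const_nat subn1.
have -> : \sum_(1 <= tau < N.+1) J tau =
    2 * (X 0%N * (N%:R + N%:R) + \sum_(1 <= v < N./2) X v * N%:R).
  under eq_bigr => tau _ do rewrite -[J tau]mulr1.
  rewrite (pair_J (fun=> 1)) big_ltn // sum1; congr (2 * (_ * (_ + _) + _)).
    by rewrite -[RHS]sum1; apply: eq_bigr => tau _; rewrite mulr0 cos0 mulr1.
  apply: eq_big_nat => v v_lt.
  under eq_bigr => tau _ do rewrite mul1r.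
  by rewrite sum_cos_period ?addr0 //; lia.
by rewrite -mulr_suml; field.
Qed.

End Inversion.

Theorem proposition1 (R : realType) (N : nat) (X J : nat -> R)
  (N_gt0 : (0 < N)%N) (N_even : ~~ odd N)
  (JE : forall tau : nat, (1 <= tau <= N)%N ->
    J tau = 2 * \sum_(0 <= u < N./2)
                  X u * (1 + cos (2 * pi / N%:R * tau%:R * u%:R))) :
  ((forall u : nat, (1 <= u < N./2)%N ->
      X u = N%:R^-1 * \sum_(1 <= tau < N.+1)
                        J tau * cos (2 * pi / N%:R * tau%:R * u%:R)) /\
   X 0%N = (4 * N%:R)^-1 * \sum_(1 <= tau < N.+1) J tau
           - 2^-1 * \sum_(1 <= u1 < N./2) X u1) /\
  (forall x : nat -> R,
    (forall u : nat, (1 <= u <= N)%N ->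
      x u = complex.Re (ifft N (fun k => (J k)%:C) u *
                        cexp ('i%C * (2 * pi / N%:R * (u%:R - 1))%:C))) ->
    (forall u : nat, (1 <= u < N./2)%N -> X u = x u.+1) /\
    X 0%N = (4 * N%:R)^-1 * \sum_(1 <= tau < N.+1) J tau
            - 2^-1 * \sum_(1 <= u1 < N./2) X u1).
Proof.
split; first by split=> [u u_lt|]; [exact: cos_inversion|exact: mean_inversion].
move=> x xE; split=> [u u_lt|]; last exact: mean_inversion.
rewrite xE; last by lia.
by rewrite Re_ifft_shift -(natr1 u) addrK; exact: cos_inversion.
Qed.
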